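(* For every $n$-node weighted graph $G$, $k\ge1$ and positive integer $f$, the output $H$ of the (unmodified) Light Fault-Tolerant Greedy Spanner Algorithm on input $(G,k,f)$ satisfies $$\ell_{2f}(H\mid G)\le O\big(f^{1/2}\cdot\lambda(n,k+1)\big).$$
   Context: Graphs have nonnegative edge weights; $w(H)$ total weight; $\mathrm{mst}(H)$ a minimum spanning tree (forest). A subgraph $Q\subseteq G$ is an $f'$-EFT connectivity preserver if for every edge set $F$ with $|F|\le f'$ the connected components of $Q\setminus F$ equal those of $G\setminus F$. The $f'$-competitive lightness is $\ell_{f'}(H\mid G):=w(H)/\min_Q w(Q)$ over all $f'$-EFT connectivity preservers $Q$ of $G$. Light Fault-Tolerant Greedy Spanner Algorithm on input $(G,k,f)$: let $Q$ be a minimum-weight $2f$-EFT connectivity preserver of $G$; $H\leftarrow Q$; for each edge $(u,v)\in E(G)\setminus Q$ in nondecreasing weight order, add $(u,v)$ to $H$ iff there exists $F\subseteq E(H)$, $|F|\le f$, with $\mathrm{dist}_{H\setminus F}(u,v)>k\cdot w(u,v)$ (current $H$); return $H$. Lightness $\ell(H)=w(H)/w(\mathrm{mst}(H))$; normalized weight of a cycle $C$ is $w(C)/\max_{e\in C}w(e)$; weighted girth is the minimum normalized weight over cycles; $\lambda(n,t):=\sup\ell(G)$ over $n$-node graphs $G$ of weighted girth $>t$. *)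

(* Defs.v *)
From HB Require Import structures.
From mathcomp Require Import all_boot all_order all_algebra.
From mathcomp Require Import boolp classical_sets reals ereal.

Set Implicit Arguments.
Unset Strict Implicit.
Unset Printing Implicit Defensive.

Import Order.TTheory GRing.Theory Num.Theory.
Local Open Scope ring_scope.

(* A simple undirected graph on the vertex type V: an edge is a two-element
   set of vertices.  A subgraph is given by its edge set and keeps all the
   vertices of V, so that deleting edges is set difference. *)
Record wgraph (R : realType) (V : finType) := WGraph {
  edges : {set {set V}};
  wt : {set V} -> R;
  edges_card : forall e, e \in edges -> #|e| = 2%N;
  wt_ge0 : forall e, e \in edges -> 0 <= wt e
}.

Section Connectivity.
Variable V : finType.
Implicit Types E Q F T : {set {set V}}.

Definition edge (u v : V) : {set V} := [set u; v]%SET.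

Definition adj E : rel V := fun u v => edge u v \in E.

Definition components E : {set {set V}} :=
  equivalence_partition (connect (adj E)) [set: V]%SET.

Definition EFT_preserver (f : nat) E Q : Prop :=
  Q \subset E /\
  forall F, F \subset E -> (#|F| <= f)%N ->
    components (Q :\: F) = components (E :\: F).

(* The sequence of vertices of a simple cycle of the graph, each listed once. *)
Definition is_cycle E (c : seq V) : Prop :=
  [/\ uniq c, (3 <= size c)%N & cycle (adj E) c].

Definition spanning_forest E T : Prop :=
  [/\ T \subset E, components T = components E &
      ~ exists c, is_cycle T c].

End Connectivity.

(* The quotients below are those of \bar R, where x / 0 = +oo for x > 0 and
   0 / 0 = 0.  The minima over finite sets are written as infima in \bar R;
   the infimum of the empty set is +oo. *)
Section Weights.
Variables (R : realType) (V : finType).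
Implicit Types (E Q F H : {set {set V}}) (w : {set V} -> R).

Definition weight w E : R := \sum_(e in E) w e.

Definition walk_weight w (u : V) (p : seq V) : R :=
  \sum_(a <- pairmap (fun x y => w (edge x y)) u p) a.

Definition dist w E (u v : V) : \bar R :=
  ereal_inf [set x : \bar R | exists p : seq V,
    [/\ path (adj E) u p, last u p = v & x = (walk_weight w u p)%:E]]%classic.

Definition mst_weight w E : \bar R :=
  ereal_inf [set x : \bar R | exists T : {set {set V}},
    spanning_forest E T /\ x = (weight w T)%:E]%classic.

Definition lightness w E : \bar R := ((weight w E)%:E / mst_weight w E)%E.

Definition min_preserver_weight (f : nat) w E : \bar R :=
  ereal_inf [set x : \bar R | exists Q : {set {set V}},
    EFT_preserver f E Q /\ x = (weight w Q)%:E]%classic.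

Definition competitive_lightness (f : nat) (G : wgraph R V) H : \bar R :=
  ((weight (wt G) H)%:E / min_preserver_weight f (wt G) (edges G))%E.

Definition cycle_weight w (c : seq V) : R :=
  \sum_(x <- c) w (edge x (next c x)).

(* The starting value 0 is harmless since edge weights are nonnegative. *)
Definition cycle_max w (c : seq V) : R :=
  \big[Num.max/0]_(x <- c) w (edge x (next c x)).

Definition normalized_weight w (c : seq V) : \bar R :=
  ((cycle_weight w c)%:E / (cycle_max w c)%:E)%E.

Definition weighted_girth w E : \bar R :=
  ereal_inf [set x : \bar R | exists c : seq V,
    is_cycle E c /\ x = normalized_weight w c]%classic.

Definition min_weight_preserver (f : nat) w E Q : Prop :=
  EFT_preserver f E Q /\
  forall Q', EFT_preserver f E Q' -> weight w Q <= weight w Q'.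

Definition must_add (k : R) (f : nat) w H (e : {set V}) : Prop :=
  exists u v F, [/\ e = edge u v, F \subset H, (#|F| <= f)%N &
    ((k * w e)%:E < dist w (H :\: F) u v)%E].

Definition greedy_step (k : R) (f : nat) w H (e : {set V}) : {set {set V}} :=
  if `[< must_add k f w H e >] then (e |: H)%SET else H.

(* H is an output of the algorithm, for some choice of the minimum-weight
   preserver Q and of the nondecreasing order s in which the edges outside Q
   are scanned (ties being broken arbitrarily). *)
Definition light_FT_greedy_output (G : wgraph R V) (k : R) (f : nat) H : Prop :=
  exists (Q : {set {set V}}) (s : seq {set V}),
    [/\ min_weight_preserver (2 * f) (wt G) (edges G) Q,
        perm_eq s (enum (edges G :\: Q)),
        sorted (fun e1 e2 => wt G e1 <= wt G e2) s &
        H = foldl (greedy_step k f (wt G)) Q s].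

End Weights.

Definition lambda (R : realType) (n : nat) (t : R) : \bar R :=
  ereal_sup [set x : \bar R | exists (V : finType) (G : wgraph R V),
    [/\ #|V| = n, (t%:E < weighted_girth (wt G) (edges G))%E &
        x = lightness (wt G) (edges G)]]%classic.

(* Main.v *)
(**
Let Q be the preserver and D = H \ Q, every e in D coming with the fault set F e
that caused its addition. An edge of D is never separated in Q by a cut of at
most 2f edges. Hence, for any cost c on Q, a local-ratio (Goemans-Williamson)
argument gives T included in Q that connects the endpoints of all the edges of D
and has c(T) <= 2 / (2f + 1) * c(Q).

Let S be a subset of D such that no F e with e in S meets S. The edges e of S
whose F e misses T, together with a minimum spanning forest of their union with
T, form a graph of weighted girth > k + 1, so that they weigh at most
lambda * w(T). Charging to each edge g of T both lambda * w(g) and the weight of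
the edges of S it blocks yields (2b + 1) w(S) <= 2 lambda w(Q), as long as every
e in S has at most f - b faults in Q.

Since F e consists of edges of Q or added before e, the conflict graph on a set of
edges of D having at most d faults outside Q is d-degenerate, so the set is a
union of d + 1 such sets S. Splitting D according to whether there are at least
sqrt f faults outside Q gives w(D) = O(sqrt f * lambda * w(Q)).
*)
Require Import Defs.
From HB Require Import structures.
From mathcomp Require Import all_boot all_order all_algebra.
From mathcomp Require Import boolp classical_sets reals ereal.
From mathcomp Require Import zify lra.
(* Imported again because boolp and classical_sets shadow some of their names. *)
From mathcomp Require Import eqtype fintype finset.

Import Order.TTheory GRing.Theory Num.Theory.
Local Open Scope ring_scope.

Set Implicit Arguments.
Unset Strict Implicit.
Unset Printing Implicit Defensive.

(** * Connectivity, cuts and components of edge sets *)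

Section Connectivity.
Variable V : finType.
Implicit Types (E Z T : {set {set V}}) (X C g : {set V}) (u v x y : V).

Lemma edgeC x y : edge x y = edge y x.
Proof. exact: setUC. Qed.

Lemma edge_eq x y u v :
  edge x y = edge u v -> (x = u /\ y = v) \/ (x = v /\ y = u).
Proof.
move=> exy.
have xP : x \in edge u v by rewrite -exy set21.
have yP : y \in edge u v by rewrite -exy set22.
have uP : u \in edge x y by rewrite exy set21.
have vP : v \in edge x y by rewrite exy set22.
move: xP yP uP vP; rewrite !in_set2.
case/orP=> /eqP-> /orP[] /eqP-> /orP[] /eqP h /orP[] /eqP h';
  by rewrite ?h ?h'; tauto.
Qed.

Lemma edge_of_card2 g : #|g| = 2 -> exists x y, g = edge x y.
Proof. by move/eqP/cards2P => [x [y [_ ->]]]; exists x, y. Qed.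

Lemma connect_adjC E : connect_sym (adj E).
Proof. by apply: sym_connect_sym => x y; rewrite /adj edgeC. Qed.

Lemma connect_adjS E E' u v :
  E \subset E' -> connect (adj E) u v -> connect (adj E') u v.
Proof.
move=> /subsetP sEE'; apply: connect_sub => x y /sEE' h; exact: connect1.
Qed.

Lemma connect_add_edge E x y u v :
  connect (adj (edge x y |: E)) u v ->
  [\/ connect (adj E) u v,
      connect (adj E) u x /\ connect (adj E) y v
    | connect (adj E) u y /\ connect (adj E) x v].
Proof.
case/connectP=> p + ->; elim: p u => [|z p IH] u /=; first by constructor 1.
case/andP; rewrite {1}/adj => uz /IH {IH}.
case/setU1P: uz => [/edge_eq[[-> ->]|[-> ->]]|uz] IH.
- case: IH => [h|[_ h]|[_ h]]; [constructor 2|constructor 2|by constructor 1];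
  by split; first exact: connect0.
- case: IH => [h|[_ h]|[_ h]]; [constructor 3|by constructor 1|constructor 3];
  by split; first exact: connect0.
- have uz1 : connect (adj E) u z by exact: connect1.
  case: IH => [h|[h h']|[h h']].
  + by constructor 1; apply: connect_trans h.
  + by constructor 2; split => //; apply: connect_trans h.
  + by constructor 3; split => //; apply: connect_trans h.
Qed.

Lemma connect_add_connected E x y u v :
  connect (adj E) x y -> connect (adj (edge x y |: E)) u v ->
  connect (adj E) u v.
Proof.
move=> xy /connect_add_edge[//|[ux yv]|[uy xv]].
- by apply: connect_trans ux (connect_trans xy yv).
- by apply: connect_trans uy (connect_trans _ xv); rewrite connect_adjC.
Qed.

(** Phrased on the set [g] itself, so that no endpoints need be chosen; [cut_edge] gives the usual
    form. *)
Definition cut X g := ~~ (g \subset X) && ~~ (g \subset ~: X).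

Lemma cut_edge X x y : cut X (edge x y) = ((x \in X) != (y \in X)).
Proof. by rewrite /cut !subUset !sub1set !inE; do 2 case: (_ \in _). Qed.

Lemma connect_uncut E X u v :
  (forall g, g \in E -> ~~ cut X g) -> connect (adj E) u v ->
  (u \in X) = (v \in X).
Proof.
move=> nocut; apply: closed_connect => x y xy.
by have := nocut _ xy; rewrite cut_edge negbK => /eqP.
Qed.

Definition comp E x := [set y | connect (adj E) x y].

Definition comps E := [set comp E x | x in V].

Lemma comp_eqE E x y : (comp E x == comp E y) = connect (adj E) x y.
Proof.
apply/eqP/idP => [exy | xy].
  by have : y \in comp E y by [rewrite inE]; rewrite -exy inE.
by apply/setP=> z; rewrite !inE; apply: same_connect => //; apply: connect_adjC.
Qed.

Lemma comp_uncut E x g : g \in E -> #|g| = 2 -> ~~ cut (comp E x) g.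
Proof.
move=> gE /edge_of_card2[y [z eg]]; rewrite eg in gE *.
rewrite cut_edge negbK !inE; apply/eqP/same_connect_r; first exact: connect_adjC.
exact: connect1.
Qed.

Lemma componentsE E : components E = comps E.
Proof.
rewrite /components /equivalence_partition /comps.
by apply/setP=> C; apply/imsetP/imsetP => -[x _ ->]; exists x => //;
  apply/setP=> y; rewrite !inE.
Qed.

Lemma components_connect E E' u v :
  components E = components E' -> connect (adj E) u v = connect (adj E') u v.
Proof.
suff imp A B : comps A = comps B -> connect (adj A) u v -> connect (adj B) u v.
  by rewrite !componentsE => e; apply/idP/idP; apply: imp.
move=> e; rewrite -comp_eqE => /eqP uv.
have : comp A u \in comps B by rewrite -e imset_f.
case/imsetP=> x _ ex.
have xu : connect (adj B) x u.
  by have : u \in comp A u by [rewrite inE]; rewrite ex inE.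
have xv : connect (adj B) x v.
  by have : v \in comp A u by [rewrite uv inE]; rewrite ex inE.
by apply: connect_trans xv; rewrite connect_adjC.
Qed.

Lemma connect_components E E' :
  (forall u v, connect (adj E) u v = connect (adj E') u v) ->
  components E = components E'.
Proof.
move=> e; rewrite !componentsE; apply: eq_imset => x.
by apply/setP=> y; rewrite !inE.
Qed.

(** Sending a component to the larger one containing it maps [comps E] onto the new components, and
    it is not injective because the components of [x] and [y] merge. *)
Lemma card_comps_bridge E x y :
  ~~ connect (adj E) x y -> (#|comps (edge x y |: E)| < #|comps E|)%N.
Proof.
move=> nxy; set E' := edge x y |: E.
pose h (C : {set V}) := \bigcup_(z in C) comp E' z.
have hE z : h (comp E z) = comp E' z.
  apply/eqP; rewrite eqEsubset; apply/andP; split; last first.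
    by apply: (bigcup_sup z) => //; rewrite inE.
  apply/bigcupsP => t; rewrite inE => zt.
  suff -> : comp E' t = comp E' z by [].
  apply/eqP; rewrite comp_eqE connect_adjC.
  by apply: connect_adjS zt; apply: subsetUr.
have -> : comps E' = h @: comps E.
  by rewrite /comps -imset_comp; apply: eq_imset => z /=; rewrite hE.
rewrite ltn_neqAle leq_imset_card andbT; apply/negP => /imset_injP hinj.
have xy : connect (adj E') x y by apply: connect1; rewrite /adj setU11.
move/negP: nxy; apply; rewrite -comp_eqE; apply/eqP.
apply: hinj; rewrite ?imset_f //.
by rewrite !hE; apply/eqP; rewrite comp_eqE.
Qed.
End Connectivity.

(** * Connection demands and minimal edge sets meeting them *)

Section SteinerForest.
Variable V : finType.
Implicit Types (E Z T : {set {set V}}) (X C g : {set V}) (u v x y : V).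

(** After contraction of [Z], the edges of [T] form a forest: inserted one at a time, each merges
    two components. *)
Lemma card_comps_bridges Z T :
  (forall g, g \in T -> exists x y,
     g = edge x y /\ ~~ connect (adj (Z :|: (T :\ g))) x y) ->
  (#|T| + #|comps (Z :|: T)| <= #|comps Z|)%N.
Proof.
move: {2}#|T| (leqnn #|T|) => m; elim: m T => [|m IH] T.
  by rewrite leqn0 cards_eq0 => /eqP-> _; rewrite cards0 setU0.
have [->|[g gT]] := set_0Vmem T; first by rewrite cards0 setU0.
move=> Tm bridge; have [x [y [eg nxy]]] := bridge g gT.
have Tg := cardsD1 g T; rewrite gT add1n in Tg.
have /IH : (#|T :\ g| <= m)%N by lia.
have -> : (Z :|: T = edge x y |: (Z :|: (T :\ g))) by rewrite setUCA -eg setD1K.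
have := card_comps_bridge nxy => lt1 le2.
suff {}/le2 : forall g0, g0 \in T :\ g -> exists x0 y0, g0 = edge x0 y0 /\
   ~~ connect (adj (Z :|: ((T :\ g) :\ g0))) x0 y0.
  have arith a b c d e : a = b.+1 -> (d < c -> b + c <= e -> a + d <= e)%N by lia.
  exact: arith.
move=> g0 /setD1P[_ /bridge[x0 [y0 [-> nc]]]]; exists x0, y0; split=> //.
apply: contra nc; apply: connect_adjS; apply: setUS; apply: setSD.
exact: subsetDl.
Qed.

Lemma sum_card_cut (A B : {set {set V}}) :
  (\sum_(C in A) #|[set g in B | cut C g]|
   = \sum_(g in B) #|[set C in A | cut C g]|)%N.
Proof.
transitivity (\sum_(C in A) \sum_(g in B) (cut C g : nat))%N.
  apply: eq_bigr => C _; rewrite -sum1_card big_mkcond [RHS]big_mkcond.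
  by apply: eq_bigr => g _; rewrite inE; case: (g \in B) => //=; case: cut.
rewrite exchange_big; apply: eq_bigr => g _.
rewrite -sum1_card big_mkcond [RHS]big_mkcond; apply: eq_bigr => C _.
by rewrite inE; case: (C \in A) => //=; case: cut.
Qed.

Variable dem : rel V.

(** A boolean, so that inclusion-minimal feasible sets are available through [minset]. *)
Definition feasible T := [forall u, forall v, dem u v ==> connect (adj T) u v].

Lemma feasibleP T :
  reflect (forall u v, dem u v -> connect (adj T) u v) (feasible T).
Proof.
apply: (iffP forallP) => [h u v|h u]; last by apply/forallP=> v; apply/implyP/h.
exact/implyP/(forallP (h u)).
Qed.

Definition separates C := [exists u, exists v, dem u v && ((u \in C) != (v \in C))].

Lemma separatesP C :
  reflect (exists u v, dem u v /\ (u \in C) != (v \in C)) (separates C).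
Proof.
apply: (iffP existsP) => [[u /existsP[v /andP[]]]|[u [v [d s]]]]; first by exists u, v.
by exists u; apply/existsP; exists v; rewrite d.
Qed.

Definition active Z := [set C in comps Z | separates C].

(** The rate at which [g] is paid for when all active components grow at unit speed, as in the
    primal-dual method. *)
Definition active_degree Z g := #|[set C in active Z | cut C g]|.

(* Contracting the components of [Z] turns a minimal [T] into a forest all of
   whose leaves are active, so the average degree of active nodes is at most 2. *)
Lemma sum_active_degree_minimal Z T :
  (forall g, g \in Z -> #|g| = 2) -> (forall g, g \in T -> #|g| = 2) ->
  minset (fun T => feasible (Z :|: T)) T ->
  (\sum_(g in T) active_degree Z g <= 2 * #|active Z|)%N.
Proof.
move=> Z2 T2 /minsetP[/feasibleP feasT minT].
(* By minimality, deleting [g] breaks some demand [u v], whose connection must therefore run through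
   [g]. *)
have bridge g x y : g \in T -> g = edge x y -> exists u v, [/\ dem u v,
    ~~ connect (adj (Z :|: (T :\ g))) x y &
    (connect (adj (Z :|: (T :\ g))) u x && connect (adj (Z :|: (T :\ g))) y v) ||
    (connect (adj (Z :|: (T :\ g))) u y && connect (adj (Z :|: (T :\ g))) x v)].
  move=> gT eg; have eZT : Z :|: T = edge x y |: (Z :|: (T :\ g)).
    by rewrite setUCA -eg setD1K.
  have : ~~ feasible (Z :|: (T :\ g)).
    apply/negP => /minT; rewrite subsetDl => /(_ isT) e.
    by have := gT; rewrite -e !inE eqxx.
  rewrite negb_forall => /existsP[u]; rewrite negb_forall => /existsP[v].
  rewrite negb_imply => /andP[duv nuv]; exists u, v.
  have := feasT u v duv; rewrite eZT => uv; split=> //.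
    by apply: contra nuv => /connect_add_connected; apply.
  case/connect_add_edge: uv => [h|[-> ->]|[-> ->]] //; last by rewrite orbT.
  by rewrite h in nuv.
pose deg C := #|[set g in T | cut C g]|.
(* An edge crosses the boundary of at most two components, those of its endpoints. *)
have le_total : (\sum_(C in comps Z) deg C <= 2 * #|T|)%N.
  rewrite sum_card_cut mulnC -sum_nat_const; apply: leq_sum => g gT.
  have [x [y eg]] := edge_of_card2 (T2 g gT).
  apply: (@leq_trans #|[set comp Z x; comp Z y]|); last by rewrite cards2; case: (_ != _).
  apply/subset_leq_card/subsetP => C; rewrite !inE eg cut_edge.
  case/andP=> /imsetP[z _ ->]; rewrite !inE ![_ == comp Z _]comp_eqE.
  by do 2 case: (connect _ z _).
(* A component of [Z] that no edge of [T] leaves is still a component of [Z :|: T]. *)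
have le_T : (#|T| + #|[set C in comps Z | deg C == 0%N]| <= #|comps Z|)%N.
  apply: leq_trans (@card_comps_bridges Z T _); last first.
    move=> g gT; have [x [y eg]] := edge_of_card2 (T2 g gT).
    by exists x, y; split=> //; have [u [v []]] := bridge g x y gT eg.
  rewrite leq_add2l; apply/subset_leq_card/subsetP => C.
  rewrite inE => /andP[/imsetP[x _ eC] /eqP deg0].
  suff -> : C = comp (Z :|: T) x by apply: imset_f.
  apply/setP=> y; rewrite eC !inE; apply/idP/idP.
    by apply: connect_adjS; apply: subsetUl.
  move=> xy; suff: (x \in C) = (y \in C) by rewrite eC !inE connect0 => <-.
  apply: connect_uncut xy => g; rewrite eC.
  case/setUP=> [gZ|gT]; first by apply: comp_uncut => //; apply: Z2.
  apply/negP => cg; move/eqP: deg0; rewrite cards_eq0 => /eqP/setP/(_ g).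
  by rewrite !inE gT eC cg.
(* If [g] were the only edge of [T] leaving [C], the demand broken by deleting [g] would be
   separated by [C], making [C] active. *)
have deg_inactive C : C \in comps Z -> ~~ separates C -> (deg C != 0)%N -> (2 <= deg C)%N.
  case/imsetP=> x0 _ eC nsep deg0; rewrite ltnNge; apply/negP => deg1.
  have /cards1P[g eg] : deg C == 1%N by move: deg0 deg1; clear; lia.
  have : g \in [set g in T | cut C g] by rewrite eg set11.
  rewrite inE => /andP[gT cg]; have [x [y exy]] := edge_of_card2 (T2 g gT).
  have clos u v : connect (adj (Z :|: (T :\ g))) u v -> (u \in C) = (v \in C).
    apply: connect_uncut => h /setUP[hZ|/setD1P[hg hT]].
      by rewrite eC; apply: comp_uncut => //; apply: Z2.
    apply: contra hg => ch; rewrite -in_set1 -eg inE hT; exact: ch.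
  have [u [v [duv _ conn]]] := bridge g x y gT exy.
  move/negP: nsep; apply; apply/separatesP; exists u, v; split=> //.
  move: cg; rewrite exy cut_edge.
  case/orP: conn => /andP[/clos -> /clos <-] //; by rewrite eq_sym.
have -> : (\sum_(g in T) active_degree Z g = \sum_(C in active Z) deg C)%N.
  by rewrite sum_card_cut.
(* A touched inactive component has degree at least 2, so its own degree pays for the term
   [2 * (deg C != 0)]; an active one is paid for by the extra 2 on the right. *)
have pointwise : (\sum_(C in comps Z) ((if separates C then deg C else 0) + 2 * (deg C != 0%N))
    <= \sum_(C in comps Z) (deg C + 2 * (separates C)))%N.
  apply: leq_sum => C CZ; case: ifP => [_|/negbT /(deg_inactive _ CZ)].
    by case: (deg C != 0%N); lia.
  by case: (deg C != 0%N) => [/(_ isT)|_]; lia.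
have cardb (P : pred {set V}) : (\sum_(C in comps Z) (P C) = #|[set C in comps Z | P C]|)%N.
  rewrite -sum1_card big_mkcond [RHS]big_mkcond; apply: eq_bigr => C _.
  by rewrite inE; case: (C \in _) => //=; case: (P C).
move: pointwise; rewrite !big_split /= !big1_eq !addn0 !cardb -/(active Z).
have -> : (\sum_(C in active Z) deg C = \sum_(C in comps Z) if separates C then deg C else 0)%N.
  rewrite big_mkcond [RHS]big_mkcond; apply: eq_bigr => C _.
  by rewrite inE; case: (C \in _) => //=.
have := cardsID [set C | deg C == 0%N] (comps Z).
have -> : comps Z :&: [set C | deg C == 0%N] = [set C in comps Z | deg C == 0%N].
  by apply/setP=> C; rewrite !inE.
have -> : comps Z :\: [set C | deg C == 0%N] = [set C in comps Z | deg C != 0%N].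
  by apply/setP=> C; rewrite !inE andbC.
have arith a b c d e p q : (a <= 2 * b -> b + c <= d -> c + e = d ->
  p + (e + e) <= a + (q + q) -> p <= 2 * q)%N by lia.
move=> h1 h2; exact: (arith _ _ _ _ _ _ _ le_total le_T h1 h2).
Qed.
End SteinerForest.

(** * Weights of edge sets and cheap Steiner forests *)

Section Weight.
Variables (R : realType) (V : finType).
Implicit Types (A B T Q : {set {set V}}) (c : {set V} -> R).

Lemma weight_ge0 c A : (forall g, g \in A -> 0 <= c g) -> 0 <= weight c A.
Proof. exact: sumr_ge0. Qed.

Lemma weightID c A B : weight c A = weight c (A :&: B) + weight c (A :\: B).
Proof. exact: big_setID. Qed.

Lemma weightS c A B :
  A \subset B -> (forall g, g \in B -> 0 <= c g) -> weight c A <= weight c B.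
Proof.
move=> /setIidPr AB c0; rewrite (weightID c B A) AB lerDl weight_ge0 // => g.
by case/setDP=> /c0.
Qed.

Lemma weightU_le c A B :
  (forall g, g \in A -> 0 <= c g) ->
  weight c (A :|: B) <= weight c A + weight c B.
Proof.
move=> c0; rewrite (weightID c (A :|: B) B) setIUl setIid addrC lerD //.
  apply: weightS => //; apply/subsetP => g; rewrite !inE.
  by case: (g \in B); rewrite ?orbF.
suff -> : (A :&: B) :|: B = B by [].
by apply/setUidPr/subsetIr.
Qed.

Lemma weightU1_le c g A : 0 <= c g -> weight c (g |: A) <= c g + weight c A.
Proof.
move=> c0; apply: le_trans (weightU_le (A := [set g]) A _) _.
  by move=> h /set1P->.
by rewrite /weight big_set1.
Qed.

Lemma weightD1 c g A : g \in A -> weight c A = c g + weight c (A :\ g).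
Proof. exact: big_setD1. Qed.

(* Local-ratio form of the Goemans-Williamson algorithm: subtract from [c] the
   largest multiple of the active degree that keeps it nonnegative. *)
Lemma steiner_forest (dem : rel V) (N : nat) Q c :
  (0 < N)%N -> (forall g, g \in Q -> #|g| = 2) ->
  (forall (X : {set V}) u v, dem u v -> (u \in X) != (v \in X) ->
     (N <= #|[set g in Q | cut X g]|)%N) ->
  (forall g, g \in Q -> 0 <= c g) ->
  exists T, [/\ T \subset Q, feasible dem T &
                N%:R * weight c T <= 2 * weight c Q].
Proof.
move=> N0 Q2 cutQ.
(* Induction on the number of edges of nonzero cost. *)
move: {2}#|[set g in Q | c g != 0]| (leqnn #|[set g in Q | c g != 0]|) => m.
elim: m c => [|m IH] c.
  rewrite leqn0 cards_eq0 => /eqP cz c0.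
  have cQ0 g : g \in Q -> c g = 0.
    move=> gQ; apply/eqP; apply/negPn/negP => ng.
    by have := in_set0 g; rewrite -cz inE gQ ng.
  exists Q; split=> //.
    (* [Q] is itself feasible: otherwise the component of [u] in [Q] would be a separating cut with
       no edge, against [0 < N]. *)
    apply/feasibleP => u v duv; apply/negPn/negP => nuv.
    have := cutQ (comp Q u) u v duv; rewrite !inE connect0 (negbTE nuv) => /(_ isT).
    suff -> : [set g in Q | cut (comp Q u) g] = finset.set0.
      by rewrite cards0 leqNgt N0.
    apply/setP=> g; rewrite !inE; apply/negP => /andP[gQ].
    by apply/negP; apply: comp_uncut => //; apply: Q2.
  by rewrite /weight big1 ?mulr0.
move=> cm c0; pose Z := [set g in Q | c g == 0].
have ZQ : Z \subset Q by apply/subsetP=> g; rewrite inE => /andP[].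
have Z2 g : g \in Z -> #|g| = 2 by move/(subsetP ZQ); apply: Q2.
have cZ0 : weight c Z = 0 by apply: big1 => g; rewrite inE => /andP[_ /eqP].
have [feasZ|] := boolP (feasible dem Z).
  exists Z; split=> //; rewrite cZ0 mulr0 mulr_ge0 // weight_ge0 //.
rewrite negb_forall => /existsP[u]; rewrite negb_forall => /existsP[v].
rewrite negb_imply => /andP[duv nuv].
pose d g : R := (active_degree dem Z g)%:R.
have degZ g : g \in Z -> active_degree dem Z g = 0%N.
  move=> gZ; apply/eqP; rewrite cards_eq0; apply/eqP/setP=> C; rewrite !inE.
  apply/negP => /andP[/andP[/imsetP[x _ ->] _]].
  by apply/negP; apply: comp_uncut => //; apply: Z2.
have actu : comp Z u \in active dem Z.
  rewrite inE imset_f //=; apply/separatesP; exists u, v; split=> //.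
  by rewrite !inE connect0 (negbTE nuv).
have [g1 g1P] : exists g, g \in [set g in Q | cut (comp Z u) g].
  apply/set0Pn; rewrite -card_gt0; apply: leq_trans N0 (cutQ _ u v duv _).
  by rewrite !inE connect0 (negbTE nuv).
pose P := [set g in Q | (0 < active_degree dem Z g)%N].
have {g1P} g1P : g1 \in P.
  move: g1P; rewrite !inE => /andP[-> cg1] /=; apply/card_gt0P.
  by exists (comp Z u); rewrite inE actu.
(* The minimal ratio is the largest multiple of [d] that can be subtracted; the edge [g0] attaining
   it becomes free, which makes the induction progress. *)
case: (@Order.TotalTheory.arg_minP _ R _ g1 (mem P) (fun g => c g / d g) g1P) => g0 g0P ming0.
pose eps := c g0 / d g0.
have dP g : g \in P -> 0 < d g by rewrite inE ltr0n => /andP[].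
have PQ g : g \in P -> g \in Q by rewrite inE => /andP[].
have eps0 : 0 <= eps by rewrite divr_ge0 ?c0 ?PQ // ltW ?dP.
pose c' g := c g - eps * d g.
have c'0 g : g \in Q -> 0 <= c' g.
  move=> gQ; rewrite subr_ge0; have [gP|gP] := boolP (g \in P).
    by rewrite -ler_pdivlMr ?dP //; apply: ming0.
  suff -> : d g = 0 by rewrite mulr0 c0.
  by move: gP; rewrite inE gQ /= lt0n negbK /d => /eqP->.
have weight_c' A : weight c A = weight c' A + eps * weight d A.
  rewrite /weight mulr_sumr -big_split /=; apply: eq_bigr => g _.
  by rewrite subrK.
have c'm : (#|[set g in Q | c' g != 0%R]| <= m)%N.
  rewrite -ltnS; apply: leq_trans cm; apply: proper_card; apply/properP; split.
    apply/subsetP=> g; rewrite !inE => /andP[gQ]; rewrite gQ /=.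
    apply: contra => /eqP cg; have gZ : g \in Z by rewrite inE gQ cg eqxx.
    by rewrite /c' cg /d degZ // mulr0 subr0.
  exists g0; rewrite !inE PQ //=; last first.
    by rewrite negbK subr_eq0 /eps divfK // gt_eqF ?dP.
  apply/negP => /eqP cg0; have : g0 \in Z by rewrite inE PQ // cg0 eqxx.
  by move/degZ => e; have := dP g0 g0P; rewrite /d e ltxx.
have [T [TQ feasT leT]] := IH c' c'm c'0.
(* The reverse-delete step: only a solution minimal relative to the free edges [Z] obeys the average
   degree bound. *)
have [|T' minT' T'T] := @minset_exists _ (fun T => feasible dem (Z :|: T)) T.
  apply/feasibleP => x y /(feasibleP _ _ feasT); apply: connect_adjS; exact: subsetUr.
have T'Q : T' \subset Q := subset_trans T'T TQ.
exists (Z :|: T'); split; first by rewrite subUset ZQ.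
  by case/minsetP: minT'.
have degT' : weight d T' <= 2 * #|active dem Z|%:R.
  rewrite /weight -natr_sum -natrM ler_nat; apply: sum_active_degree_minimal => //.
  by move=> g /(subsetP T'Q); apply: Q2.
(* Each active component separates a demand, hence is left by at least [N] edges of [Q]. *)
have degQ : N%:R * #|active dem Z|%:R <= weight d Q.
  rewrite /weight -natr_sum -natrM ler_nat mulnC -sum_nat_const.
  rewrite /active_degree -sum_card_cut; apply: leq_sum => C.
  by rewrite inE => /andP[_ /separatesP[x [y [dxy]]]]; apply: cutQ.
have h1 : weight c (Z :|: T') <= weight c T'.
  by apply: le_trans (weightU_le _ _) _; rewrite ?cZ0 ?add0r // => g /(subsetP ZQ)/c0.
have h2 : weight c' T' <= weight c' T.
  by apply: weightS => // g /(subsetP TQ)/c'0.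
have NR : (0 : R) < N%:R by rewrite ltr0n.
rewrite (weight_c' Q); rewrite (weight_c' T') in h1.
have h3 : N%:R * weight d T' <= 2 * weight d Q.
  apply: le_trans (_ : N%:R * (2 * #|active dem Z|%:R) <= _).
    by rewrite ler_pM2l.
  by rewrite mulrCA ler_pM2l // ltr0n.
apply: le_trans (_ : N%:R * (weight c' T' + eps * weight d T') <= _).
  by rewrite ler_pM2l.
rewrite !mulrDr lerD //.
  by apply: le_trans leT; rewrite ler_pM2l.
by rewrite mulrCA [leRHS]mulrCA ler_wpM2l.
Qed.
End Weight.

(** * Cycles, weighted girth and minimal connecting subgraphs *)

Section Cycles.
Variables (R : realType) (V : finType).
Implicit Types (E M T : {set {set V}}) (w : {set V} -> R) (c p : seq V).

Definition cycle_edges c : {set {set V}} := [set edge z (next c z) | z in c].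

Lemma mem_cycle_edges c z : z \in c -> edge z (next c z) \in cycle_edges c.
Proof. exact: (imset_f (fun z => edge z (next c z))). Qed.

Lemma cycle_edges_sub E c : is_cycle E c -> cycle_edges c \subset E.
Proof.
by case=> _ _ cyc; apply/subsetP=> g /imsetP[z zc ->]; apply: next_cycle cyc zc.
Qed.

Lemma walk_weight_next w c a p x :
  path (frel (next c)) a (rcons p x) ->
  walk_weight w a (rcons p x) = \sum_(z <- a :: p) w (edge z (next c z)).
Proof.
rewrite /walk_weight; elim: p a => [|b p IH] a /=.
  by move=> /andP[/eqP<- _]; rewrite !big_seq1.
by move=> /andP[/eqP e /IH]; rewrite !(big_cons, e) /= => ->.
Qed.

Lemma path_next_avoid c a p x :
  path (frel (next c)) a (rcons p x) -> x \notin a :: p ->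
  {subset a :: p <= c} ->
  path (fun y z => [&& y \in c, y != x & z == next c y]) a (rcons p x).
Proof.
elim: p a => [|b p IH] a /= /andP[/eqP e h].
  rewrite inE eq_sym => -> /(_ a (mem_head _ _)) ->.
  by rewrite e eqxx.
rewrite inE negb_or eq_sym => /andP[-> xp] sub.
rewrite sub ?mem_head // e eqxx /=; apply: IH => // z zp.
by apply: sub; rewrite inE zp orbT.
Qed.

(** Going round the cycle from [next c x] back to [x] uses every edge but the first. *)
Lemma cycle_split w c x : uniq c -> (3 <= size c)%N -> x \in c ->
  exists p, [/\ path (adj (cycle_edges c :\ edge x (next c x))) (next c x) p,
    last (next c x) p = x &
    cycle_weight w c = w (edge x (next c x)) + walk_weight w (next c x) p].
Proof.
move=> Uc sz xc; case: (rot_to xc) => i p0 erot.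
have Ur : uniq (x :: p0) by rewrite -erot rot_uniq.
have nextE z : next (x :: p0) z = next c z by rewrite -erot next_rot.
have : (3 <= size (x :: p0))%N by rewrite -erot size_rot.
case: p0 Ur nextE erot => [//|y [//|z p]] Ur nextE erot _.
have : cycle (frel (next c)) [:: x, y, z & p].
  rewrite -(eq_cycle (e := frel (next [:: x, y, z & p]))) ?cycle_next // => a b.
  by congr (_ == b); apply: nextE.
case/andP=> /eqP nx pth0; rewrite nx.
have {pth0} pth : path (frel (next c)) y (rcons (z :: p) x) by [].
exists (rcons (z :: p) x); split.
- have xyp : x \notin [:: y, z & p] by case/andP: Ur.
  have sub : {subset [:: y, z & p] <= c}.
    by move=> a ap; rewrite -(mem_rot i) erot inE ap orbT.
  move: (path_next_avoid pth xyp sub); apply: sub_path => a b /and3P[ac ax /eqP->].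
  (* The removed edge could recur only if traversed backwards from [y] to [x], but a third vertex
     [z] follows [y]. *)
  rewrite /adj in_setD1 mem_cycle_edges // andbT; apply/negP => /eqP/edge_eq.
  case=> [[/eqP]|[ay bx]]; first by rewrite (negbTE ax).
  move: pth bx; rewrite /= ay => /andP[/eqP -> _] zx.
  by move: Ur; rewrite /= zx !inE eqxx !orbT.
- by rewrite last_rcons.
- rewrite (walk_weight_next _ pth) /cycle_weight.
  have pc : perm_eq c (rot i c) by rewrite perm_sym perm_rot.
  by rewrite (perm_big _ pc) erot [LHS]big_cons nx.
Qed.

Lemma cycle_edge_connect c x : uniq c -> (3 <= size c)%N -> x \in c ->
  connect (adj (cycle_edges c :\ edge x (next c x))) x (next c x).
Proof.
move=> Uc sz xc; have [p [pth lst _]] := cycle_split (fun=> 0 : R) Uc sz xc.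
by rewrite connect_adjC; apply/connectP; exists p.
Qed.

(** The strict inequality survives the infimum because only finitely many cycles exist: they repeat
    no vertex, so they are tuples of length at most [#|V|]. *)
Lemma weighted_girth_gt w E (t : R) :
  (forall c, is_cycle E c -> (t%:E < normalized_weight w c)%E) ->
  (t%:E < weighted_girth w E)%E.
Proof.
move=> h; pose I := {n : 'I_#|V|.+1 & n.-tuple V}.
pose m := \big[Order.min/+oo%E]_(i : I | `[< is_cycle E (tagged i) >])
  normalized_weight w (tagged i).
apply: (@lt_le_trans _ _ m).
  by rewrite /m; elim/big_ind: _ => [|a b ha hb|i /asboolP/h //];
     rewrite ?ltry // lt_min ha.
apply/ereal_infP => _ [c [cyc ->]].
have szc : (size c < #|V|.+1)%N.
  by case: cyc => Uc _ _; rewrite ltnS -(card_uniqP Uc) max_card.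
pose i : I := Tagged (fun n : 'I_#|V|.+1 => n.-tuple V) (i := Ordinal szc) (in_tuple c).
rewrite /m (bigD1 i) /=; last exact/asboolP.
by rewrite ge_min lexx.
Qed.

Lemma cycle_maxE w c e : e \in cycle_edges c ->
  (forall g, g \in cycle_edges c -> 0 <= w g <= w e) -> cycle_max w c = w e.
Proof.
case/imsetP=> x xc -> max; apply/eqP; rewrite eq_le; apply/andP; split; last first.
  rewrite /cycle_max; elim: {1 3}c xc => [//|y s IH]; rewrite inE big_cons.
  by case/orP=> [/eqP <-|/IH h]; rewrite le_max ?lexx ?h ?orbT.
rewrite /cycle_max big_seq.
have w0 := max _ (mem_cycle_edges xc).
elim/big_ind: _ => [|a b ha hb|y yc]; first by case/andP: w0.
  by rewrite ge_max ha.
by case/andP: (max _ (mem_cycle_edges yc)).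
Qed.

(** Spanning is treated as a Steiner problem whose demands are all pairs connected in [E]. *)
Definition connectivity_equiv E M := feasible (connect (adj E)) M.

Lemma connectivity_equiv_components E M :
  M \subset E -> connectivity_equiv E M -> components M = components E.
Proof.
move=> ME /feasibleP h; apply: connect_components => u v; apply/idP/idP.
  exact: connect_adjS.
exact: h.
Qed.

Lemma minimal_connectivity_bridge E M x y :
  minset (connectivity_equiv E) M -> edge x y \in M ->
  ~~ connect (adj (M :\ edge x y)) x y.
Proof.
move=> /minsetP[/feasibleP h min] gM; apply/negP => xy.
have /min : connectivity_equiv E (M :\ edge x y).
  apply/feasibleP => u v /h; rewrite -{1}(setD1K gM).
  exact: connect_add_connected.
rewrite subsetDl => /(_ isT) e.
by have := gM; rewrite -e !inE eqxx.
Qed.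

Lemma minimal_connectivity_acyclic E M :
  minset (connectivity_equiv E) M -> ~ exists c, is_cycle M c.
Proof.
move=> minM [c cyc]; have := cycle_edges_sub cyc => /subsetP sub.
case: cyc => Uc sz cyc; case: c => [//|x c] in Uc sz cyc sub *.
have gM : edge x (next (x :: c) x) \in M.
  by apply/sub/mem_cycle_edges/mem_head.
have /negP := minimal_connectivity_bridge minM gM; apply.
apply: connect_adjS (cycle_edge_connect Uc sz (mem_head _ _)).
by apply: setSD; apply/subsetP.
Qed.
End Cycles.

(** * Weight of the added edges, for abstract fault sets *)

Section LightSubgraph.
Variables (R : realType) (V : finType) (w : {set V} -> R).
Variables (k L : R) (Q D : {set {set V}}).
(** Here [D] stands for the edges added to the preserver [Q], [rk] for the position in the scan,
    [F e] for the fault set that forced [e] in, and [L] for the value of [lambda]. *)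
Variables (rk : {set V} -> nat) (F : {set V} -> {set {set V}}).
Implicit Types (E M S T : {set {set V}}).

Hypothesis edges2 : forall g, g \in Q :|: D -> #|g| = 2.
Hypothesis w_ge0 : forall g, g \in Q :|: D -> 0 <= w g.
Hypothesis rk_inj : {in D &, injective rk}.
Hypothesis rk_le_w : {in D &, forall e e', (rk e' <= rk e)%N -> w e' <= w e}.
Hypothesis F_dist : forall e x y p, e \in D -> e = edge x y ->
  path (adj ((Q :|: [set e' in D | (rk e' < rk e)%N]) :\: F e)) x p ->
  last x p = y -> k * w e < walk_weight w x p.
Hypothesis light : forall E M, E \subset Q :|: D ->
  ((k + 1)%:E < weighted_girth w E)%E -> spanning_forest E M ->
  weight w E <= L * weight w M.
Hypothesis L_ge0 : 0 <= L.

(* The spanning forest is taken of minimum weight so that an edge of [S] is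
   heaviest on every cycle; the last scanned edge of [S] on a cycle is then
   a heaviest one too, and its fault set misses the rest of the cycle. *)
Lemma weight_unblocked_le S T :
  T \subset Q -> S \subset D -> feasible (adj S) T ->
  (forall e, e \in S -> [disjoint F e & T]) ->
  (forall e e', e \in S -> e' \in S -> e' \notin F e) ->
  weight w S <= L * weight w T.
Proof.
move=> TQ SD /feasibleP connT disjT indepS.
pose X := T :|: S.
have XQD : X \subset Q :|: D by apply: setUSS.
have wX g : g \in X -> 0 <= w g by move/(subsetP XQD)/w_ge0.
have equivT : connectivity_equiv X T.
  apply/feasibleP => u v; apply: connect_sub => x y /setUP[|/connT //].
  exact: connect1.
pose good M := (M \subset X) && connectivity_equiv X M.
have goodT : good T by rewrite /good subsetUl.
have [M0 goodM0 minM0] : exists2 M, good M & forall M', good M' -> weight w M <= weight w M'.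
  by case: (@Order.TotalTheory.arg_minP _ R _ T good (weight w) goodT) => M gM h; exists M.
(* Edges of weight 0 may close cycles in a minimum-weight [M0]; an inclusion-minimal part of it is a
   forest and weighs no more. *)
have [M minM MM0] := minset_exists (proj2 (andP goodM0)).
have MX : M \subset X := subset_trans MM0 (proj1 (andP goodM0)).
have equivM : connectivity_equiv X M by case/minsetP: minM.
have wminM M' : good M' -> weight w M <= weight w M'.
  move=> /minM0; apply: le_trans; apply: weightS => // g.
  by move/(subsetP (proj1 (andP goodM0)))/wX.
pose E := S :|: M.
have EX : E \subset X by rewrite subUset subsetUr.
have forestM : spanning_forest E M.
  split; [exact: subsetUr| |exact: minimal_connectivity_acyclic minM].
  apply: connectivity_equiv_components; first exact: subsetUr.
  apply/feasibleP => u v /(connect_adjS EX); exact/feasibleP.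
have wM : weight w M <= weight w T by apply: wminM.
apply: le_trans (_ : L * weight w M <= _); last exact: ler_wpM2l.
apply: le_trans (_ : weight w E <= _).
  by apply: weightS => [|g /(subsetP EX)/wX //]; apply: subsetUl.
apply: light => //; first exact: subset_trans XQD.
apply: weighted_girth_gt => c cyc.
have cE := cycle_edges_sub cyc; case: (cyc) => Uc szc _.
have wc g : g \in cycle_edges c -> 0 <= w g by move/(subsetP cE)/(subsetP EX)/wX.
have [g gc maxg] : exists2 g, g \in cycle_edges c & forall h, h \in cycle_edges c -> w h <= w g.
  have [x xc] : exists x, x \in c by case: (c) szc => // x s _; exists x; apply: mem_head.
  by case: (@Order.TotalTheory.arg_maxP _ R _ _ (mem (cycle_edges c)) w (mem_cycle_edges xc)) => g ? ?; exists g.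
(* If the heaviest edge [g] lies in [M], the rest of the cycle recrosses the cut left by deleting
   [g] from [M], in an edge [e] of [S]; exchanging [g] for [e] keeps connectivity, so [e] weighs at
   least as much. *)
have [e1 e1c [e1S ge1]] : exists2 e, e \in cycle_edges c & e \in S /\ w g <= w e.
  have [gS|gS] := boolP (g \in S); first by exists g.
  have gM : g \in M by move/(subsetP cE): (gc); rewrite inE (negbTE gS).
  have [x xc eg] := imsetP gc; set y := next c x in eg.
  have nxy : ~~ connect (adj (M :\ g)) x y.
    by rewrite eg; apply: (minimal_connectivity_bridge minM); rewrite -eg.
  have xy : connect (adj (cycle_edges c :\ g)) x y.
    by rewrite eg; apply: (cycle_edge_connect R).
  have [e /setD1P[eg' ec] cute] : exists2 e, e \in cycle_edges c :\ g & cut (comp (M :\ g) x) e.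
    apply: contrapT => nocut; move/negP: nxy; apply.
    suff: (x \in comp (M :\ g) x) = (y \in comp (M :\ g) x).
      by rewrite !inE connect0 => <-.
    by apply: connect_uncut xy => h hc; apply/negP => cuth; apply: nocut; exists h.
  have g2 h : h \in M -> #|h| = 2 by move/(subsetP MX)/(subsetP XQD)/edges2.
  have eM : e \notin M :\ g.
    apply/negP => eM; have e2 : #|e| = 2 by apply: g2; case/setD1P: eM.
    by have := comp_uncut x eM e2; rewrite cute.
  have eS : e \in S.
    move/(subsetP cE): (ec); rewrite inE; case/orP => // h.
    by move: eM; rewrite in_setD1 eg' h.
  exists e => //; split=> //.
  have [a ac ee] := imsetP ec; set b := next c a in ee.
  have nab : ~~ connect (adj (M :\ g)) a b.
    move: cute; rewrite ee cut_edge !inE; apply: contra => ab; apply/eqP.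
    by apply: same_connect_r => //; apply: connect_adjC.
  have Mg : M = edge x y |: (M :\ g) by rewrite -eg setD1K.
  have abM : connect (adj M) a b.
    move/feasibleP: equivM; apply; apply: connect1; rewrite /adj -ee.
    exact: (subsetP EX _ (subsetP cE _ ec)).
  pose M' := e |: (M :\ g).
  have sub' : M :\ g \subset M' by apply: subsetUr.
  have ab' : connect (adj M') a b by apply: connect1; rewrite /adj -ee setU11.
  have xy' : connect (adj M') x y.
    move: abM; rewrite {1}Mg => /connect_add_edge[h|[ax yb]|[ay xb]].
    - by rewrite h in nab.
    - rewrite connect_adjC in ax; apply: connect_trans (connect_adjS sub' ax) _.
      by apply: connect_trans ab' _; rewrite connect_adjC (connect_adjS sub').
    - apply: connect_trans (connect_adjS sub' xb) _; rewrite connect_adjC in ab'.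
      by apply: connect_trans ab' (connect_adjS sub' ay).
  have goodM' : good M'.
    apply/andP; split.
      rewrite subUset sub1set (subsetP EX _ (subsetP cE _ ec)).
      exact: subset_trans (subsetDl _ _) MX.
    apply/feasibleP => u v uv; apply: (connect_add_connected xy').
    move/feasibleP: equivM => /(_ _ _ uv); rewrite {1}Mg; apply: connect_adjS.
    exact: setUS.
  have := le_trans (wminM _ goodM') (weightU1_le (M :\ g) (wc e ec)).
  by rewrite (weightD1 _ gM) lerD2r.
have [e eSc maxe] : exists2 e, e \in S :&: cycle_edges c &
    forall h, h \in S :&: cycle_edges c -> (rk h <= rk e)%N.
  have e1Sc : e1 \in S :&: cycle_edges c by rewrite inE e1S.
  by case: (@arg_maxnP _ e1 (mem (S :&: cycle_edges c)) rk e1Sc) => e ? ?; exists e.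
have /setIP[eS ec] := eSc; have eD := subsetP SD _ eS.
have wmaxe h : h \in cycle_edges c -> 0 <= w h <= w e.
  move=> hc; rewrite wc //=; apply: le_trans (maxg h hc) (le_trans ge1 _).
  by apply: rk_le_w => //; [apply: (subsetP SD)| apply: maxe; rewrite inE e1S].
have [x xc ee] := imsetP ec; set y := next c x in ee.
have [p [pth lst cwE]] := cycle_split w Uc szc xc.
(* The rest of the cycle avoids [F e]: its edges in [T] by disjointness, those in [S] by
   independence. Its edges in [S] precede [e] in the scan. *)
have we : k * w e < walk_weight w y p.
  apply: (F_dist (x := y) (y := x)) lst => //; first by rewrite edgeC.
  move: pth; apply: sub_path => a b; rewrite /adj -/y -ee => /setD1P[].
  move: (edge a b) => h hne hc; rewrite inE; apply/andP; split.
    have /setUP[hT|hS] := subsetP EX _ (subsetP cE _ hc); last exact: indepS.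
    by apply/negP => hF; have /pred0P/(_ h) := disjT e eS; rewrite /= hF hT.
  have /setUP[hT|hS] := subsetP EX _ (subsetP cE _ hc).
    by rewrite inE (subsetP TQ).
  rewrite !inE (subsetP SD) //= ltn_neqAle; apply/orP; right; apply/andP; split.
    apply/eqP => /rk_inj erk; move/eqP: hne; apply; apply: erk => //.
    exact: (subsetP SD).
  by apply: maxe; rewrite inE hS.
rewrite -/y -ee in cwE.
have cw : (k + 1) * w e < cycle_weight w c by rewrite cwE mulrDl mul1r addrC ltrD2l.
rewrite /normalized_weight (cycle_maxE ec wmaxe) inver.
have we0 : 0 < w e.
  case/andP: (wmaxe e ec) => + _; rewrite le_eqVlt => /orP[/eqP e0|//].
  move: cw; rewrite -e0 mulr0 /cycle_weight big_seq big1 ?ltxx // => z zc.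
  by have := wmaxe _ (mem_cycle_edges zc); rewrite -e0 -eq_le => /eqP <-.
by rewrite gt_eqF // -EFinM lte_fin ltr_pdivlMr.
Qed.

Variable f : nat.
Hypothesis disjoint_QD : [disjoint Q & D].
Hypothesis F_card : forall e, e \in D -> (#|F e| <= f)%N.
Hypothesis F_early : forall e e', e \in D -> e' \in D -> e' \in F e ->
  (rk e' < rk e)%N.
Hypothesis conn_Q : forall e X, e \in D -> cut X e ->
  (2 * f < #|[set g in Q | cut X g]|)%N.

Lemma sum_fault_cost S (A : {set {set V}}) :
  weight (fun g => \sum_(e in S | g \in F e) w e) A
  = \sum_(e in S) #|F e :&: A|%:R * w e.
Proof.
rewrite /weight (exchange_big_dep (mem S)) /=; last by move=> g e _ /andP[].
apply: eq_bigr => e eS; rewrite (eq_bigl (mem (F e :&: A))).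
  by rewrite sumr_const mulr_natl.
by move=> g; rewrite !inE eS andbC.
Qed.

(* The Steiner forest is charged [L * w g] for an edge [g], plus the weight of
   all the edges of [S] having [g] in their fault set. *)
Lemma weight_independent_le S b :
  S \subset D -> (forall e e', e \in S -> e' \in S -> e' \notin F e) ->
  (forall e, e \in S -> #|F e :&: Q| + b <= f)%N ->
  (2 * b + 1)%:R * weight w S <= 2 * L * weight w Q.
Proof.
move=> SD indepS Fb.
have wS e : e \in S -> 0 <= w e by move/(subsetP SD) => eD; apply: w_ge0; rewrite inE eD orbT.
have wQ g : g \in Q -> 0 <= w g by move=> gQ; apply: w_ge0; rewrite inE gQ.
pose y g := \sum_(e in S | g \in F e) w e.
pose c g := y g + L * w g.
have cE A : weight c A = \sum_(e in S) #|F e :&: A|%:R * w e + L * weight w A.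
  by rewrite -sum_fault_cost /weight mulr_sumr -big_split.
have [||||T [TQ feasT leT]] := @steiner_forest R V (adj S) (2 * f + 1) Q c.
- by rewrite addn1.
- by move=> g gQ; apply: edges2; rewrite inE gQ.
- move=> X u v uvS; rewrite -cut_edge addn1; apply: conn_Q; exact: (subsetP SD).
- move=> g gQ; apply: addr_ge0; last by rewrite mulr_ge0 ?wQ.
  by apply: sumr_ge0 => e /andP[eS _]; apply: wS.
pose S' := [set e in S | [disjoint F e & T]].
have S'S : S' \subset S by apply/subsetP=> e; rewrite inE => /andP[].
have wS' : weight w S' <= L * weight w T.
  apply: weight_unblocked_le => //; first exact: subset_trans SD.
  - apply/feasibleP => u v uv; move/feasibleP: feasT; apply.
    exact: (subsetP S'S).
  - by move=> e; rewrite inE => /andP[].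
  - by move=> e e' /(subsetP S'S) eS /(subsetP S'S); apply: indepS.
have wS_cT : weight w S <= weight c T.
  rewrite cE (weightID w S S') addrC lerD //; last by rewrite (setIidPr S'S).
  rewrite /weight big_mkcond [leRHS]big_mkcond; apply: ler_sum => e _.
  rewrite in_setD inE; case: (boolP (e \in S)) => //= eS.
  case: (boolP [disjoint F e & T]) => /= [_|]; first by rewrite mulr_ge0 ?wS.
  rewrite -setI_eq0 -card_gt0 => F0.
  by rewrite -{1}[w e]mul1r ler_wpM2r ?wS // ler1n.
(* Each [e] is charged once per fault in [Q], hence at most [f - b] times; this leaves
   [(2f + 1) - 2(f - b) = 2b + 1] copies of [w S]. *)
have yQ : \sum_(e in S) #|F e :&: Q|%:R * w e <= (f%:R - b%:R) * weight w S.
  rewrite /weight mulr_sumr; apply: ler_sum => e eS.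
  by rewrite ler_wpM2r ?wS // lerBrDr -natrD ler_nat Fb.
have wS0 : 0 <= weight w S by apply: weight_ge0.
have h : (2 * f + 1)%:R * weight w S <= 2 * weight c Q.
  by apply: le_trans leT; rewrite ler_wpM2l.
have natE n : (2 * n + 1)%:R = 2 * n%:R + 1 :> R by rewrite natrD natrM.
move: h; rewrite cE !natE; lra.
Qed.

(** Colour in scanning order: by [F_early] the last edge lies in no other fault set of [A], so it
    must avoid at most [d] of the [d + 1] colours. *)
Lemma degenerate_coloring (A : {set {set V}}) d :
  A \subset D -> (forall e, e \in A -> #|F e :&: A| <= d)%N ->
  exists col : {set V} -> 'I_d.+1, forall e e',
    e \in A -> e' \in A -> e' \in F e -> col e != col e'.
Proof.
move: {2}#|A| (leqnn #|A|) => m; elim: m A => [|m IH] A.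
  by rewrite leqn0 cards_eq0 => /eqP-> _ _; exists (fun=> ord0) => e e'; rewrite inE.
have [->|[a aA]] := set_0Vmem A.
  by move=> _ _ _; exists (fun=> ord0) => e e'; rewrite inE.
case: (@arg_maxnP _ a (mem A) rk aA) => e0 e0M maxe0 Am AD Fd {a aA}.
have {e0M} e0A : e0 \in A := e0M.
have Ae0 : (#|A :\ e0| <= m)%N by move: Am; rewrite (cardsD1 e0) e0A add1n ltnS.
have [||col colP] := IH _ Ae0.
- exact: subset_trans (subsetDl _ _) AD.
- move=> e /setD1P[_ eA]; apply: leq_trans (Fd e eA).
  by apply/subset_leq_card/setIS/subsetDl.
have [i iP] : exists i, i \notin [set col e | e in F e0 :&: A].
  apply/existsP; rewrite -negb_forall; apply/negP => /forallP full.
  have : (#|[set: 'I_d.+1]| <= #|[set col e | e in F e0 :&: A]|)%N.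
    by apply/subset_leq_card/subsetP => i _; apply: full.
  rewrite cardsT card_ord leqNgt ltnS => /negP; apply.
  exact: leq_trans (leq_imset_card _ _) (Fd e0 e0A).
exists (fun e => if e == e0 then i else col e) => e e' eA e'A e'F.
have rke := F_early (subsetP AD _ eA) (subsetP AD _ e'A) e'F.
have e'e0 : e' != e0.
  by apply: contraTneq rke => ->; rewrite -leqNgt; apply: maxe0.
rewrite (negbTE e'e0); case: ifP => [/eqP ee0|/negbT ee0].
  apply/negP => /eqP ei; move/negP: iP; apply; rewrite ei; apply: imset_f.
  by rewrite inE -ee0 e'F.
by apply: colP => //; rewrite !inE ?ee0 ?e'e0.
Qed.

Lemma weight_class_le (A : {set {set V}}) b d :
  A \subset D -> (forall e, e \in A -> #|F e :&: D| <= d)%N ->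
  (forall e, e \in A -> #|F e :&: Q| + b <= f)%N ->
  (2 * b + 1)%:R * weight w A <= d.+1%:R * (2 * L * weight w Q).
Proof.
move=> AD Fd Fb; have [|col colP] := @degenerate_coloring A d AD.
  by move=> e eA; apply: leq_trans (Fd e eA); apply/subset_leq_card/setIS.
rewrite {1}/weight (partition_big col xpredT) //= mulr_sumr.
have -> : d.+1%:R * (2 * L * weight w Q) = \sum_(i < d.+1) 2 * L * weight w Q.
  by rewrite sumr_const card_ord mulr_natl.
apply: ler_sum => i _.
rewrite (eq_bigl (mem [set e in A | col e == i])); last by move=> e; rewrite !inE.
apply: weight_independent_le.
- by apply/subsetP=> e; rewrite inE => /andP[/(subsetP AD)].
- move=> e e'; rewrite !inE => /andP[eA /eqP ei] /andP[e'A /eqP e'i].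
  by apply/negP => /(colP _ _ eA e'A); rewrite ei e'i eqxx.
- by move=> e; rewrite inE => /andP[/Fb].
Qed.

(* Edges with few faults outside [Q] need few colours, and for those with many
   the Steiner forest has more slack; [r] balances the two. *)
Lemma weight_added_le (r : nat) :
  (0 < r)%N -> (f < r.+1 ^ 2)%N -> weight w D <= 6 * r%:R * L * weight w Q.
Proof.
move=> r0 fr; pose A := [set e in D | (#|F e :&: D| < r)%N].
have cardF e : e \in D -> (#|F e :&: Q| + #|F e :&: D| <= f)%N.
  move=> eD; apply: leq_trans (F_card eD).
  rewrite -cardsUI; have -> : (F e :&: Q) :&: (F e :&: D) = finset.set0.
    apply/setP=> g; rewrite !inE; apply/negP => /andP[/andP[_ gQ] /andP[_ gD]].
    by have /pred0P/(_ g) := disjoint_QD; rewrite /= gQ gD.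
  by rewrite cards0 addn0 -setIUr; apply/subset_leq_card/subsetIl.
(* Few faults in [D]: [r] colour classes, with no slack ([b = 0]). *)
have lowP : (2 * 0 + 1)%:R * weight w (D :&: A) <= r.-1.+1%:R * (2 * L * weight w Q).
  apply: weight_class_le; first exact: subsetIl.
  - by move=> e; rewrite !inE => /and3P[_ _]; rewrite -{1}(prednK r0).
  - by move=> e /setIP[eD _]; rewrite addn0; apply: leq_trans (cardF e eD); apply: leq_addr.
(* At least [r] faults in [D] leave at most [f - r] in [Q], so [b = r], with the crude count of
   [f + 1] classes. *)
have highP : (2 * r + 1)%:R * weight w (D :\: A) <= f.+1%:R * (2 * L * weight w Q).
  apply: weight_class_le; first exact: subsetDl.
  - move=> e /setDP[eD _]; apply: leq_trans (F_card eD).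
    exact/subset_leq_card/subsetIl.
  - move=> e /setDP[eD]; rewrite inE eD /= -leqNgt => re.
    by apply: leq_trans (cardF e eD); rewrite leq_add2l.
rewrite prednK // in lowP; rewrite (weightID w D A).
have W0 : 0 <= 2 * L * weight w Q.
  by rewrite !mulr_ge0 // weight_ge0 // => g gQ; apply: w_ge0; rewrite inE gQ.
(* As [f + 1 <= (r + 1)^2 <= (2r + 1)(r + 1)], the slack cancels. The two bounds then add up to
   [2r + 1 <= 3r] copies of [2 * L * weight w Q]. *)
have {}highP : (2 * r + 1)%:R * weight w (D :\: A)
    <= (2 * r + 1)%:R * (r.+1%:R * (2 * L * weight w Q)).
  apply: le_trans highP _; rewrite [leRHS]mulrA ler_wpM2r // -natrM ler_nat; nia.
rewrite ler_pM2l ?ltr0n ?addn1 // in highP.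
have r1 : 1 <= r%:R :> R by rewrite ler1n.
have rW : 2 * L * weight w Q <= r%:R * (2 * L * weight w Q) by rewrite ler_peMl.
move: lowP highP; rewrite -natr1 mulrDl; lra.
Qed.
End LightSubgraph.

(** * Fault sets produced by the greedy scan *)

Section Greedy.
Variables (R : realType) (V : finType) (k : R) (f : nat) (w : {set V} -> R).
Implicit Types (A E : {set {set V}}) (s : seq {set V}).

Lemma greedy_supset A s : A \subset foldl (greedy_step k f w) A s.
Proof.
elim: s A => //= e s IH A; apply: subset_trans (IH _).
by rewrite /greedy_step; case: ifP => // _; apply: subsetUr.
Qed.

Lemma greedy_subset A s :
  foldl (greedy_step k f w) A s \subset A :|: [set e | e \in s].
Proof.
elim: s A => [|e s IH] A /=; first exact: subsetUl.
apply: subset_trans (IH _) _; apply/subsetP=> g; rewrite /greedy_step !inE.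
by case: ifP => _; rewrite ?inE; do 2 case: (_ \in _); rewrite ?orbT ?orbF //= ?orbT.
Qed.

Lemma walk_weight_rcons (x y : V) p :
  walk_weight w x (rcons p y) = walk_weight w x p + w (edge (last x p) y).
Proof.
rewrite /walk_weight; elim: p x => [|z p IH] x /=; rewrite !big_cons ?big_nil ?add0r ?addr0 //.
by rewrite IH addrA.
Qed.

Lemma walk_rev E (x : V) p : path (adj E) x p ->
  exists q, [/\ path (adj E) (last x p) q, last (last x p) q = x &
                walk_weight w (last x p) q = walk_weight w x p].
Proof.
elim: p x => [|z p IH] x /=; first by exists [::].
case/andP=> xz /IH[q [pq lq wq]]; exists (rcons q x); split.
- by rewrite rcons_path pq lq /adj edgeC.
- by rewrite last_rcons.
- by rewrite walk_weight_rcons wq lq edgeC addrC [RHS]/walk_weight /= big_cons.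
Qed.

(** Reversing walks makes the bound independent of the order in which the endpoints of [e] are
    named. *)
Lemma must_add_faults A e : must_add k f w A e ->
  exists F : {set {set V}}, [/\ F \subset A, (#|F| <= f)%N &
    forall x y p, e = edge x y -> path (adj (A :\: F)) x p -> last x p = y ->
      k * w e < walk_weight w x p].
Proof.
move=> [u [v [F [eE FA Ff far]]]]; exists F; split=> // x y p exy pth lst.
have walk q : path (adj (A :\: F)) u q -> last u q = v -> k * w e < walk_weight w u q.
  move=> pq lq; rewrite -lte_fin; apply: lt_le_trans far _.
  by apply: ereal_inf_lbound; exists q.
have [[xu yv]|[xv yu]] := edge_eq (etrans (esym exy) eE).
  by subst x y v; apply: walk.
have [q [pq lq <-]] := walk_rev pth.
by move: pq lq; rewrite lst yu => pq lq; apply: walk; rewrite ?lq.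
Qed.

(** [A] recovers, from the final output alone, the graph current when [e] was scanned: the scan
    never deletes an edge, and later additions have larger index. *)
Lemma greedy_faults (Q : {set {set V}}) s e :
  uniq s -> (forall g, g \in s -> g \notin Q) ->
  let H := foldl (greedy_step k f w) Q s in
  e \in H :\: Q ->
  let A := Q :|: [set g in H :\: Q | (index g s < index e s)%N] in
  e \in s /\
  exists F : {set {set V}}, [/\ F \subset A, (#|F| <= f)%N &
    forall x y p, e = edge x y -> path (adj (A :\: F)) x p -> last x p = y ->
      k * w e < walk_weight w x p].
Proof.
move=> Us sQ H /setDP[eH eQ] A.
have es : e \in s by have := subsetP (greedy_subset _ _) _ eH; rewrite !inE (negbTE eQ).
split=> //; case/splitPr: es @H @A Us sQ eH => s1 s2 H A Us sQ eH.
move: Us; rewrite cat_uniq /= => /and4P[Us1 /norP[es1 s12] es2 Us2].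
pose B := foldl (greedy_step k f w) Q s1.
have HB : H = foldl (greedy_step k f w) (greedy_step k f w B e) s2.
  by rewrite /H foldl_cat.
have eB : e \notin B.
  apply/negP => /(subsetP (greedy_subset _ _)).
  by rewrite !inE (negbTE eQ) (negbTE es1).
have addB : must_add k f w B e.
  move: eH; rewrite HB => /(subsetP (greedy_subset _ _)).
  rewrite !inE (negbTE es2) orbF /greedy_step.
  by case: asboolP => // _; rewrite (negbTE eB).
have idxe : index e (s1 ++ e :: s2) = size s1.
  by rewrite index_cat (negbTE es1) /= eqxx addn0.
have idx g : (index g (s1 ++ e :: s2) < size s1)%N = (g \in s1).
  by rewrite index_cat; case: ifP => gs1; rewrite ?index_mem // ltnNge leq_addr.
suff -> : A = B by exact: must_add_faults.
apply/setP=> g; rewrite !inE idxe idx; apply/idP/idP.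
  case/orP=> [gQ|/andP[/andP[gQ gH] gs1]]; first exact: (subsetP (greedy_supset _ _)).
  apply/negPn/negP => gB; move: gH; rewrite HB => /(subsetP (greedy_subset _ _)).
  rewrite !inE /greedy_step; case: asboolP => // _; rewrite !inE (negbTE gB) orbF.
  case/orP=> [/eqP ge|gs2]; first by move/negP: es1; apply; rewrite -ge.
  by move/hasPn: s12 => /(_ g gs2); rewrite gs1.
move=> gB; have := subsetP (greedy_subset _ _) _ gB; rewrite !inE.
case: (boolP (g \in Q)) => //= _ ->; rewrite andbT HB.
apply: (subsetP (greedy_supset _ _)); rewrite /greedy_step; case: ifP => // _.
by rewrite inE gB orbT.
Qed.
End Greedy.

(** * Bounds drawn from [lambda] *)

Section Lambda.
Variables (R : realType) (V : finType) (G : wgraph R V) (t : R).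
Implicit Types (E M : {set {set V}}).

Lemma lambda_ge_subgraph E : E \subset edges G ->
  (t%:E < weighted_girth (wt G) E)%E ->
  (lightness (wt G) E <= lambda #|V| t)%E.
Proof.
move=> /subsetP EG girth; apply: ereal_sup_ubound.
exists V, (WGraph (fun e eE => edges_card (EG e eE)) (fun e eE => wt_ge0 (EG e eE))).
by split.
Qed.

Lemma lambda_ge0 : (0 <= lambda #|V| t)%E.
Proof.
have := @lambda_ge_subgraph finset.set0 (sub0set _).
rewrite /lightness /weight big_set0 mul0e; apply.
apply: weighted_girth_gt => c [_ sz cyc].
by case: c sz cyc => [//|x [//|y c]] _ /andP[]; rewrite /adj inE.
Qed.

Lemma weight_le_lambda (L : R) E M : lambda #|V| t = L%:E -> E \subset edges G ->
  (t%:E < weighted_girth (wt G) E)%E -> spanning_forest E M ->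
  weight (wt G) E <= L * weight (wt G) M.
Proof.
move=> lamE EG girth forestM; have := lambda_ge_subgraph EG girth.
have L0 : 0 <= L by rewrite -lee_fin -lamE lambda_ge0.
have wE e : e \in E -> 0 <= wt G e by move/(subsetP EG)/wt_ge0.
rewrite lamE /lightness; set m := mst_weight _ _.
have m0 : (0 <= m)%E.
  apply/ereal_infP => _ [T [[TE _ _] ->]]; rewrite lee_fin weight_ge0 //.
  by move=> e /(subsetP TE)/wE.
have mM : (m <= (weight (wt G) M)%:E)%E by apply: ereal_inf_lbound; exists M.
have WE : 0 <= weight (wt G) E by apply: weight_ge0.
case: m m0 mM => [m| |] //; rewrite !lee_fin => m0 mM h.
apply: le_trans (_ : L * m <= _); last by rewrite ler_wpM2l.
(* With a spanning forest weight of 0, a positive weight of [E] would give infinite lightness,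
   against the finite [L]. *)
move: h; rewrite inver; case: eqP => [->|/eqP mn0] h.
  rewrite mulr0; move: WE; rewrite le_eqVlt => /orP[/eqP <- //|W0].
  by move: h; rewrite gt0_muley ?lte_fin.
by move: h; rewrite -EFinM lee_fin ler_pdivrMr // lt_neqAle eq_sym mn0.
Qed.

Lemma single_edge_acyclic (g : {set V}) c : ~ is_cycle [set g] c.
Proof.
case=> + + cyc; case: c cyc => [|x [|y [|z c]]] //= /and3P[/set1P xy /set1P yz _].
move=> + _; have [[-> _]|[-> _]] := edge_eq (etrans xy (esym yz)).
  by rewrite !inE eqxx.
by rewrite !inE eqxx !orbT.
Qed.

(** A single edge of positive weight is a graph of lightness 1; this lets the weight of the
    preserver itself be absorbed in the final bound. *)
Lemma lambda_ge1 (L : R) g : lambda #|V| t = L%:E ->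
  g \in edges G -> 0 < wt G g -> 1 <= L.
Proof.
move=> lamE gG w0; have := @weight_le_lambda L [set g] [set g] lamE.
rewrite sub1set gG /weight big_set1 ler_pMl //; apply=> //.
  by apply: weighted_girth_gt => c /single_edge_acyclic.
by split=> // -[c /single_edge_acyclic].
Qed.
End Lambda.

(** * Cuts of a preserver, and the competitive lightness bound *)

Lemma preserver_cut (V : finType) (f : nat) (E Q : {set {set V}}) e X :
  EFT_preserver f E Q -> e \in E :\: Q -> #|e| = 2 -> cut X e ->
  (f < #|[set g in Q | cut X g]|)%N.
Proof.
move=> [QE pres] /setDP[eE eQ] /edge_of_card2[x [y exy]].
rewrite ltnNge exy cut_edge => sep; apply/negP => small.
have FQ : [set g in Q | cut X g] \subset Q by apply/subsetP=> g; rewrite inE => /andP[].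
(* Deleting the edges of [Q] across [X] spares [e], which is outside [Q], yet leaves [Q] with no
   edge across [X]. *)
have xy : connect (adj (E :\: [set g in Q | cut X g])) x y.
  by apply: connect1; rewrite /adj -exy !inE (negbTE eQ).
rewrite -(components_connect _ _ (pres _ (subset_trans FQ QE) small)) in xy.
move/eqP: sep; apply; apply: connect_uncut xy => g.
by rewrite !inE => /andP[+ gQ]; rewrite gQ.
Qed.


Theorem theorem3p16 (R : realType) :
  exists C : R, 0 < C /\
  forall (n : nat) (V : finType) (G : wgraph R V) (k : R) (f : nat)
         (H : {set {set V}}),
    #|V| = n -> 1 <= k -> (0 < f)%N ->
    light_FT_greedy_output G k f H ->
    (competitive_lightness (2 * f) G H
       <= (C * Num.sqrt f%:R)%:E * lambda n (k + 1))%E.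
Proof.
(* Of the constant 7, 6 comes from the added edges and 1 from [Q]. *)
exists 7; split=> // _ V G k f H <- _ f0 [Q [s [[presQ minQ] perm_s sorted_s HE]]].
have [QG _] := presQ.
set w := wt G in HE sorted_s minQ *.
have wG g : g \in edges G -> 0 <= w g by apply: wt_ge0.
have minE : min_preserver_weight (2 * f) w (edges G) = (weight w Q)%:E.
  apply/eqP; rewrite eq_le; apply/andP; split.
    by apply: ereal_inf_lbound; exists Q.
  by apply/ereal_infP => _ [Q' [/minQ le ->]]; rewrite lee_fin.
have Us : uniq s by rewrite (perm_uniq perm_s) enum_uniq.
have memS g : (g \in s) = (g \in edges G :\: Q) by rewrite (perm_mem perm_s) mem_enum.
have sQ g : g \in s -> g \notin Q by rewrite memS => /setDP[].
have C0 : 0 < 7 * Num.sqrt f%:R :> R by rewrite mulr_gt0 // sqrtr_gt0 ltr0n.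
have := lambda_ge0 G (k + 1).
case lamE : (lambda #|V| (k + 1)) => [L| |] //; last first.
  by move=> _; rewrite gt0_muley ?lte_fin // leey.
rewrite lee_fin => L0.
pose D := H :\: Q; pose rk e := index e s.
have QH : Q \subset H by rewrite HE; apply: greedy_supset.
have faults e : exists F : {set {set V}}, e \in D ->
    [/\ F \subset Q :|: [set g in D | (rk g < rk e)%N], (#|F| <= f)%N &
    forall x y p, e = edge x y ->
      path (adj ((Q :|: [set g in D | (rk g < rk e)%N]) :\: F)) x p ->
      last x p = y -> k * w e < walk_weight w x p].
  have [eD|eD] := boolP (e \in D); last by exists finset.set0.
  by rewrite /D HE in eD *; have [_ [F FP]] := greedy_faults Us sQ eD; exists F.
have [F FP] := boolp.choice faults.
have Ds e : e \in D -> e \in s.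
  by move=> eD; rewrite /D HE in eD; case: (greedy_faults Us sQ eD).
have DG : D \subset edges G :\: Q by apply/subsetP=> e /Ds; rewrite memS.
have QDG : Q :|: D \subset edges G.
  by rewrite subUset QG; apply: subset_trans DG (subsetDl _ _).
have s1 : 1 <= Num.sqrt f%:R :> R by rewrite -[leLHS]sqrtr1 ler_wsqrtr // ler1n.
pose r := Num.truncn (Num.sqrt (f%:R : R)).
have /andP[rle ltr] := truncn_itv (sqrtr_ge0 (f%:R : R)).
have r0 : (0 < r)%N by rewrite truncn_gt0.
have fr : (f < r.+1 ^ 2)%N.
  rewrite -(ltr_nat R) natrX -[ltLHS]sqr_sqrtr ?ler0n //.
  by rewrite ltrXn2r ?nnegrE ?sqrtr_ge0 ?ler0n.
have wD : weight w D <= 6 * r%:R * L * weight w Q.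
  apply: (@weight_added_le R V w k L Q D rk F) fr => //.
  - by move=> g /(subsetP QDG)/edges_card.
  - by move=> g /(subsetP QDG)/wG.
  - move=> e e' eD e'D erk; rewrite -(nth_index e (Ds _ eD)) -(nth_index e (Ds _ e'D)).
    by rewrite -/(rk e) -/(rk e') erk.
  - move=> e e' eD e'D; apply: (sorted_leq_index _ _ sorted_s); [|by move=> ?|exact: Ds|exact: Ds].
    by move=> ? ? ?; apply: le_trans.
  - by move=> e x y p /FP[_ _]; apply.
  - move=> E M EQD girth forestM; apply: weight_le_lambda lamE _ girth forestM.
    exact: subset_trans EQD QDG.
  - by apply/pred0P => g /=; rewrite inE; case: (g \in Q).
  - by move=> e /FP[].
  - move=> e e' eD e'D e'F; have [/subsetP sub _ _] := FP e eD.
    have := sub _ e'F; rewrite inE; case/orP; last by rewrite inE => /andP[].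
    by move=> e'Q; case/setDP: e'D; rewrite e'Q.
  - move=> e X eD; apply: (preserver_cut presQ (subsetP DG _ eD)).
    by apply: (@edges_card _ _ G); apply: (subsetP QDG); rewrite inE eD orbT.
have wH : weight w H = weight w Q + weight w D by rewrite (weightID w H Q) (setIidPr QH).
have WQ : 0 <= weight w Q by apply: weight_ge0 => g /(subsetP QG)/wG.
have WD : 0 <= weight w D.
  by apply: weight_ge0 => g gD; apply/wG/(subsetP QDG); rewrite inE gD orbT.
rewrite /competitive_lightness minE wH -EFinM.
(* If [Q] weighs 0 then so does [D], and the quotient is [0 / 0 = 0]. *)
have [wQ0|wQ0] := eqVneq (weight w Q) 0.
  rewrite wQ0 mulr0 in wD; have -> : weight w D = 0 by apply/le_anti; rewrite wD.
  by rewrite wQ0 addr0 mul0e lee_fin mulr_ge0 // ltW.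
have WQ' : 0 < weight w Q by rewrite lt_neqAle eq_sym wQ0.
have L1 : 1 <= L.
  have [g gQ wg] : exists2 g, g \in Q & 0 < w g.
    apply: contrapT => none; move/eqP: wQ0; apply; apply: big1 => g gQ.
    apply/le_anti; rewrite (wG _ (subsetP QG _ gQ)) andbT leNgt; apply/negP => wg.
    by apply: none; exists g.
  exact: lambda_ge1 lamE (subsetP QG _ gQ) wg.
rewrite inver (negbTE wQ0) -EFinM lee_fin ler_pdivrMr //.
have sL : 1 <= Num.sqrt f%:R * L by apply: mulr_ege1.
have h1 : weight w Q <= Num.sqrt f%:R * L * weight w Q by rewrite ler_peMl.
have h2 : r%:R * L * weight w Q <= Num.sqrt f%:R * L * weight w Q.
  by rewrite !ler_wpM2r.
move: wD h1 h2; rewrite -!mulrA; lra.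
Qed.
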